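(* Let $n\ge 1$ and $0\le k\le n$ be integers with $n\neq 2k$. Then the Johnson graph $J(n,k)$ is not a square.
   Context: The Johnson graph $J(n,k)$ has as vertices the $k$-element subsets of $\{1,\dots,n\}$, two being adjacent iff their intersection has exactly $k-1$ elements. All graphs are finite and simple. A partially labeled graph is a graph $H$ together with an injective map $\theta: L\to V(H)$, $L\subseteq\mathbb{N}$, whose image $\theta(L)$ is nonempty and a proper subset of $V(H)$; vertices in $\theta(L)$ are labeled. The square $HH$ is obtained from two disjoint copies of $H$ by identifying each labeled vertex $\theta(\ell)$ of the first copy with $\theta(\ell)$ of the second copy (keeping all edges, merging double edges). A graph $G$ is a square if $G\cong HH$ for some partially labeled graph $H$. *)

(* Defs.v *)
From HB Require Import structures.
From mathcomp Require Import all_boot finmap.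

Set Implicit Arguments.
Unset Strict Implicit.
Unset Printing Implicit Defensive.

Record sgraph := SGraph {
  vertex :> finType;
  adj : rel vertex;
  adj_sym : symmetric adj;
  adj_irr : irreflexive adj }.

Definition isomorphic (G H : sgraph) : Prop :=
  exists2 f : G -> H, bijective f & forall x y : G, adj (f x) (f y) = adj x y.

Section Johnson.
Variables n k : nat.

Definition johnson_vertex : finType := {A : {set 'I_n} | #|A| == k}.

(* [#|A :&: B| = k - 1] is stated without the truncated subtraction, which
   would put a loop on the single vertex when [k = 0]. *)
Definition johnson_adj : rel johnson_vertex :=
  [rel A B | #|val A :&: val B|.+1 == k].

Fact johnson_adj_sym : symmetric johnson_adj.
Proof. by move=> A B; rewrite /johnson_adj /= setIC. Qed.

Fact johnson_adj_irr : irreflexive johnson_adj.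
Proof. by move=> A; rewrite /johnson_adj /= setIid (eqP (valP A)) eqn_leq ltnn. Qed.

Definition Johnson : sgraph := SGraph johnson_adj_sym johnson_adj_irr.

End Johnson.

(* An injection of a subset of [nat] into the vertices of a finite graph has a
   finite domain, so label sets are finite sets of natural numbers. *)
Record plgraph := PLGraph {
  pl_graph :> sgraph;
  pl_labels : {fset nat};
  pl_theta : pl_labels -> pl_graph;
  pl_theta_inj : injective pl_theta;
  pl_labeled_nonempty : [set pl_theta l | l : pl_labels] != set0;
  pl_labeled_proper : [set pl_theta l | l : pl_labels] \proper [set: pl_graph] }.

Section Square.
Variable H : plgraph.

Definition copies_adj : rel (H + H) := fun x y =>
  match x, y with
  | inl u, inl v => adj u v
  | inr u, inr v => adj u v
  | _, _ => false
  end.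

Definition glue : rel (H + H) := fun x y =>
  match x, y with
  | inl u, inl v => u == v
  | inr u, inr v => u == v
  | inl u, inr v | inr u, inl v =>
      [exists l, (u == pl_theta l) && (v == pl_theta l)]
  end.

Fact glue_equiv : {in [set: H + H] & &, equivalence_rel glue}.
Proof.
have E (u w : H) l : u == pl_theta l ->
    [exists m, (u == pl_theta m) && (w == pl_theta m)] = (u == w).
  move=> lu; apply/existsP/eqP => [[m /andP[/eqP-> /eqP->]] //|<-].
  by exists l; rewrite lu.
move=> x y z _ _ _; split; first by case: z => u /=.
case: x y z => [u|u] [v|v] [w|w] /=; try by move=> /eqP->.
all: case/existsP=> l /andP[lu lv]; rewrite (E _ _ l) //.
all: by rewrite (eqP lu) (eqP lv).
Qed.

(* The vertices of [HH] are the [glue]-classes of the vertices of the disjoint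
   union of two copies of [H]. *)
Definition square_vertex : finType :=
  {A : {set H + H} | A \in equivalence_partition glue [set: H + H]}.

Definition square_adj : rel square_vertex := fun A B =>
  [exists x in val A, [exists y in val B, copies_adj x y]].

Fact square_adj_sym : symmetric square_adj.
Proof.
have sC : symmetric copies_adj by case=> u [v|v] //=; rewrite adj_sym.
suff imp A B : square_adj A B -> square_adj B A by move=> A B; apply/idP/idP; exact: imp.
by case/exists_inP=> x xA /exists_inP[y yB xy];
  apply/exists_inP; exists y => //; apply/exists_inP; exists x; rewrite // sC.
Qed.

Fact square_adj_irr : irreflexive square_adj.
Proof.
move=> A; apply/negbTE/negP; case/exists_inP=> x xA /exists_inP[y yA].
case/imsetP: (valP A) => z _ Az; move: xA yA; rewrite Az !inE /= => zx zy.
have: glue x y.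
  have [_ e] := glue_equiv (in_setT z) (in_setT x) (in_setT y).
  by rewrite -(e zx).
by case: x y {zx zy} => [u|u] [v|v] //= /eqP->; rewrite adj_irr.
Qed.

Definition square : sgraph := SGraph square_adj_sym square_adj_irr.

End Square.

Definition is_square (G : sgraph) : Prop := exists H : plgraph, isomorphic G (square H).

(* Main.v *)
Require Import Defs.
From mathcomp Require Import all_boot.
From mathcomp Require Import zify.

Set Implicit Arguments.
Unset Strict Implicit.
Unset Printing Implicit Defensive.

(** Exchanging the two copies of [H] is an involutive automorphism of [HH].
    Its non-fixed vertices are split in two sides, which it swaps and between
    which there are no edges; it has both fixed and non-fixed vertices.
    Given such a [sigma] on [J(n,k)], connectedness yields a fixed [S] with a
    non-fixed neighbour [P = S - i + m]; let [sigma P = S - j + m'].  As [P]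
    and [sigma P] lie on different sides they are not adjacent, so [i <> j]
    and [m <> m'], and their common neighbour [Q = S - i + m'] is fixed.
    Hence [sigma] maps the triangle [S, P, Q] to the triangle [S, sigma P, Q].
    The first has [n - k - 2] common neighbours, the [S - i + y], and the second
    [k - 2], the [S - x + m'].  Therefore [n = 2k]. *)

(** * The exchange of the two copies in a square *)

Lemma square_swap (G : sgraph) : is_square G ->
  exists (sigma : G -> G) (side : pred G),
    [/\ involutive sigma,
        forall x y, adj (sigma x) (sigma y) = adj x y,
        (exists x, sigma x = x) /\ (exists x, sigma x <> x),
        forall x, sigma x <> x -> side (sigma x) = ~~ side x
      & forall x y, sigma x <> x -> sigma y <> y -> adj x y -> side x = side y].
Proof.
case=> H [f [g fK gK] f_adj].
pose swap (x : H + H) : H + H :=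
  match x with inl u => inr u | inr u => inl u end.
have swapK : involutive swap by case.
have glueN x y : glue (swap x) (swap y) = glue x y by case: x y => u [].
have copiesN x y : copies_adj (swap x) (swap y) = copies_adj x y.
  by case: x y => u [].
pose cl x := [set z : H + H in [set: H + H] | glue x z].
have clP x : cl x \in equivalence_partition (@glue H) [set: H + H].
  by apply/imsetP; exists x.
have clE (A : square H) : exists x, val A = cl x.
  by have /imsetP[x _ ->] := valP A; exists x.
have memN x (B : {set H + H}) : (x \in swap @: B) = (swap x \in B).
  by rewrite -{1}[x]swapK mem_imset //; exact: (inv_inj swapK).
have swapP (A : square H) :
    swap @: val A \in equivalence_partition (@glue H) [set: H + H].
  have [x ->] := clE A; suff -> : swap @: cl x = cl (swap x) by [].
  by apply/setP=> z; rewrite memN !inE -glueN swapK.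
pose s (A : square H) : square H := Sub (swap @: val A) (swapP A).
have sK : involutive s.
  by move=> A; apply: val_inj; apply/setP=> z; rewrite /= !memN swapK.
have adj_imp A B : adj A B -> adj (s A) (s B).
  case/exists_inP=> x xA /exists_inP[y yB xy].
  apply/exists_inP; exists (swap x); first by rewrite memN swapK.
  by apply/exists_inP; exists (swap y); rewrite ?memN ?swapK ?copiesN.
have s_adj A B : adj (s A) (s B) = adj A B.
  by apply/idP/idP=> [/adj_imp|/adj_imp //]; rewrite !sK.
(* The side of a vertex of [HH] is the copy of [H] that its class meets; only the classes of labeled
   vertices meet both. *)
pose isl (A : square H) := [exists u, inl u \in val A].
pose isr (A : square H) := [exists u, inr u \in val A].
have islN A : isl (s A) = isr A by apply: eq_existsb => u; rewrite memN.
have isl_isr A : isl A || isr A.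
  have [x Ax] := clE A.
  have: x \in val A by rewrite Ax !inE; case: (x) => u /=.
  by case: x {Ax} => u uA; apply/orP; [left | right]; apply/existsP; exists u.
(* Members [inl u] and [inr v] of one class are glued, so [u] and [v] are the same labeled vertex
   and [swap] maps the class to itself. *)
have fix_both A : isl A -> isr A -> s A = A.
  case/existsP=> u uA /existsP[v vA].
  have inA x z : x \in val A -> (z \in val A) = glue x z.
    have [w ->] := clE A; rewrite !inE /= => wx.
    by have [_ /(_ wx)] := glue_equiv (in_setT w) (in_setT x) (in_setT z).
  have := vA; rewrite (inA _ _ uA) /= => /existsP[l /andP[/eqP uE /eqP vE]].
  apply: val_inj; apply/setP=> z; rewrite memN (inA _ _ uA) -glueN swapK.
  by rewrite (inA _ _ vA) uE vE.
have nfix A : s A <> A -> isr A = ~~ isl A.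
  move=> nA; have := isl_isr A; have := @fix_both A.
  by case: (isl A); case: (isr A) => // /(_ isT isT).
have flip A : s A <> A -> isl (s A) = ~~ isl A by move=> nA; rewrite islN nfix.
(* An edge of [HH] comes from an edge inside one copy, and a non-fixed class meets only one copy. *)
have noedge A B : s A <> A -> s B <> B -> adj A B -> isl A = isl B.
  move=> nA nB /exists_inP[[u|u] uA /exists_inP[[v|v] vB //= _]].
    by transitivity true; [|symmetry]; apply/existsP; [exists u|exists v].
  by apply: negb_inj; rewrite -!nfix //; transitivity true; [|symmetry];
    apply/existsP; [exists u|exists v].
have glue_cl (x : H + H) : x \in cl x by rewrite !inE; case: x => u /=.
have fixS : exists A, s A = A.
  have /set0Pn[_ /imsetP[l _ _]] := pl_labeled_nonempty H.
  exists (Sub (cl _) (clP (inl (pl_theta l)))); apply: fix_both.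
    by apply/existsP; exists (pl_theta l); exact: glue_cl.
  apply/existsP; exists (pl_theta l); rewrite !inE /=.
  by apply/existsP; exists l; rewrite eqxx.
(* Were the class of an unlabeled [inl u] fixed, it would contain [inr u], and [u] would be
   labeled. *)
have nfixS : exists A, s A <> A.
  have /properP[_ [u _ uN]] := pl_labeled_proper H.
  exists (Sub (cl _) (clP (inl u))) => /(congr1 val)/setP/(_ (inl u)).
  rewrite memN glue_cl !inE /= => /existsP[l /andP[/eqP uE _]].
  by case/negP: uN; rewrite uE; apply/imsetP; exists l.
have nfix_f x : g (s (f x)) <> x -> s (f x) <> f x.
  by move=> nx e; apply: nx; rewrite e fK.
exists (fun x => g (s (f x))), (fun x => isl (f x)); split.
- by move=> x; rewrite gK sK fK.
- by move=> x y; rewrite -f_adj !gK s_adj f_adj.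
- case: fixS nfixS => A eA [B nB]; split; first by exists (g A); rewrite gK eA.
  by exists (g B); rewrite gK => /(can_inj gK).
- by move=> x /nfix_f nx; rewrite gK flip.
- by move=> x y /nfix_f nx /nfix_f ny; rewrite -f_adj; exact: noedge.
Qed.

(** * Replacing one element of a set by another *)

Section Exchange.
Variable T : finType.
Implicit Types (S A : {set T}) (i j m l : T).

Definition exchange S i m := m |: (S :\ i).

Lemma card_exchange S i m : i \in S -> m \notin S -> #|exchange S i m| = #|S|.
Proof. by move=> iS mS; rewrite cardsU1 !inE (negbTE mS) andbF (cardsD1 i S) iS. Qed.

Lemma setI_exchange S i m : m \notin S -> S :&: exchange S i m = S :\ i.
Proof.
move=> mS; apply/setP=> x; rewrite !inE.
have [->|_] := eqVneq x m; first by rewrite (negbTE mS) andbF.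
by case: (x \in S); rewrite ?andbF.
Qed.

Lemma exchangeP S A : #|A| = #|S| -> #|S :&: A|.+1 = #|S| ->
  exists i m, [/\ i \in S, m \notin S & A = exchange S i m].
Proof.
move=> cA cI.
have /cards1P[i Ei] : #|S :\: A| == 1 by have := cardsID A S; lia.
have /cards1P[m Em] : #|A :\: S| == 1.
  by have := cardsID S A; rewrite setIC; lia.
have /setDP[iS iA] : i \in S :\: A by rewrite Ei set11.
have /setDP[mA mS] : m \in A :\: S by rewrite Em set11.
exists i, m; split=> //; apply/setP=> x.
move/setP/(_ x): Ei; move/setP/(_ x): Em; rewrite !inE => <- <-.
by case: (x \in A); case: (x \in S).
Qed.

(** The intersection is [S :\ i :\ j], together with [m] when [m = l]. So the left-hand cardinal
    plus one is [#|S| - [i != j] + [m == l]], which is [#|S|] iff exactly one of the two equalities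
    holds. *)
Lemma card_setI_exchange S i j m l :
  i \in S -> j \in S -> m \notin S -> l \notin S ->
  (#|exchange S i m :&: exchange S j l|.+1 == #|S|) = (i == j) (+) (m == l).
Proof.
move=> iS jS mS lS.
have cD : #|S :\ i :\ j| + (i != j) = #|S|.-1.
  have := cardsD1 j (S :\ i); have := cardsD1 i S.
  rewrite !inE iS jS (eq_sym j) andbT; lia.
have S0 : 0 < #|S| by rewrite (cardsD1 i) iS.
have -> : #|exchange S i m :&: exchange S j l| = (m == l) + #|S :\ i :\ j|.
  have [<-|ml] := eqVneq m l.
    have -> : exchange S i m :&: exchange S j m = m |: (S :\ i :\ j).
      apply/setP=> x; rewrite !inE; case: (x == m) => //=.
      by case: (x == i); case: (x == j); case: (x \in S).
    by rewrite cardsU1 !inE (negbTE mS) !andbF.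
  congr #|pred_of_set _|; apply/setP=> x; rewrite !inE.
  have [->|xm] := eqVneq x m.
    by rewrite (negbTE ml) (negbTE mS) !andbF.
  have [->|xl] := eqVneq x l; first by rewrite (negbTE lS) !andbF.
  by case: (x == i); case: (x == j); case: (x \in S).
by case: (i == j) cD; case: (m == l) => /=; lia.
Qed.

Lemma exchange_injr S i : {in ~: S &, injective (exchange S i)}.
Proof.
move=> y z; rewrite !inE => yS zS /setP/(_ y).
by rewrite !inE eqxx (negbTE yS) !andbF !orbF => /esym/eqP.
Qed.

Lemma exchange_injl S m : m \notin S -> {in S &, injective (exchange S ^~ m)}.
Proof.
move=> mS y z yS zS /setP/(_ y); rewrite !inE eqxx yS andbT.
by have [ym|_ /=] := eqVneq y m; [rewrite -ym yS in mS|case: eqVneq].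
Qed.

End Exchange.

(** * Neighbourhoods and connectedness in the Johnson graph *)

Section Johnson.
Variables n k : nat.
Implicit Types S A B C : Johnson n k.

Lemma card_johnson S : #|val S| = k. Proof. exact: (eqP (valP S)). Qed.

Lemma johnson_exchange S i m : i \in val S -> m \notin val S ->
  exists A, val A = exchange (val S) i m.
Proof.
move=> iS mS; have cA : #|exchange (val S) i m| == k.
  by rewrite card_exchange // card_johnson.
by exists (Sub (exchange (val S) i m) cA).
Qed.

Lemma johnson_adjP S A :
  reflect (exists i m,
             [/\ i \in val S, m \notin val S & val A = exchange (val S) i m])
          (adj S A).
Proof.
apply: (iffP eqP) => [cI|[i [m [iS mS ->]]]].
  by apply: exchangeP; rewrite !card_johnson.
rewrite setI_exchange //; apply: etrans (card_johnson S).
by rewrite [in RHS](cardsD1 i) iS.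
Qed.

(** With [S - i + m] placed at row [i] and column [m], the neighbourhood of [S] is a rook's graph
    with [k] rows and [n - k] columns. *)
Lemma johnson_adj_exchange S A B i j m l :
    i \in val S -> j \in val S -> m \notin val S -> l \notin val S ->
    val A = exchange (val S) i m -> val B = exchange (val S) j l ->
  adj A B = (i == j) (+) (m == l).
Proof.
move=> iS jS mS lS eA eB; rewrite -(card_setI_exchange iS jS mS lS) -eA -eB.
by rewrite card_johnson.
Qed.

Definition common_nbrs A B C := [set X | [&& adj A X, adj B X & adj C X]].

(** A neighbour of [S] outside row [i] would have to lie in both columns [m] and [l]. Hence the
    common neighbours are the other [n - k - 2] cells of that row. *)
Lemma card_common_nbrs_row S A B i m l :
    i \in val S -> m \notin val S -> l \notin val S -> m != l ->
    val A = exchange (val S) i m -> val B = exchange (val S) i l ->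
  #|common_nbrs S A B| + k + 2 = n.
Proof.
move=> iS mS lS ml eA eB.
have E : val @: common_nbrs S A B = exchange (val S) i @: (~: val S :\ m :\ l).
  apply/setP=> X; apply/imsetP/imsetP=> [[Y]|[y]].
    rewrite inE => /and3P[/johnson_adjP[x [y [xS yS eY]]]].
    rewrite (johnson_adj_exchange iS xS mS yS eA eY).
    rewrite (johnson_adj_exchange iS xS lS yS eB eY).
    have [ix|_ /= /eqP <-] := eqVneq i x; last by rewrite eq_sym (negbTE ml).
    by rewrite !addTb => my ly ->; exists y; rewrite ?eY ?ix // !inE yS !(eq_sym y) my ly.
  rewrite !inE => /and3P[yl ym yS] ->.
  have [Y eY] := johnson_exchange iS yS.
  exists Y => //; rewrite inE (johnson_adj_exchange iS iS mS yS eA eY).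
  rewrite (johnson_adj_exchange iS iS lS yS eB eY) eqxx !addTb !(eq_sym _ y) ym yl.
  by rewrite !andbT; apply/johnson_adjP; exists i, y.
rewrite -(card_imset _ val_inj) E card_in_imset; last first.
  apply: sub_in2 (@exchange_injr _ (val S) i) => y.
  by rewrite !inE => /and3P[].
have := cardsD1 l (~: val S :\ m); have := cardsD1 m (~: val S).
have := cardsC (val S); rewrite card_johnson card_ord !inE mS lS eq_sym ml /=.
lia.
Qed.

(** The transposed count: the other [k - 2] cells of column [m]. *)
Lemma card_common_nbrs_col S A B i j m :
    i \in val S -> j \in val S -> m \notin val S -> i != j ->
    val A = exchange (val S) i m -> val B = exchange (val S) j m ->
  #|common_nbrs S A B| + 2 = k.
Proof.
move=> iS jS mS ij eA eB.
have E : val @: common_nbrs S A B = (exchange (val S) ^~ m) @: (val S :\ i :\ j).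
  apply/setP=> X; apply/imsetP/imsetP=> [[Y]|[x]].
    rewrite inE => /and3P[/johnson_adjP[x [y [xS yS eY]]]].
    rewrite (johnson_adj_exchange iS xS mS yS eA eY).
    rewrite (johnson_adj_exchange jS xS mS yS eB eY).
    have [my|_] := eqVneq m y; last first.
      by rewrite !addbF => /eqP <-; rewrite eq_sym (negbTE ij).
    rewrite !addbT => ix jx ->.
    by exists x; rewrite ?eY ?my // !inE xS !(eq_sym x) ix jx.
  rewrite !inE => /and3P[xj xi xS] ->.
  have [Y eY] := johnson_exchange xS mS.
  exists Y => //; rewrite inE (johnson_adj_exchange iS xS mS mS eA eY).
  rewrite (johnson_adj_exchange jS xS mS mS eB eY) eqxx !(eq_sym _ x) !addbT.
  by rewrite xi xj !andbT; apply/johnson_adjP; exists x, m.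
rewrite -(card_imset _ val_inj) E card_in_imset; last first.
  by apply: sub_in2 (exchange_injl mS) => x; rewrite !inE => /and3P[].
have := cardsD1 j (val S :\ i); have := cardsD1 i (val S).
rewrite card_johnson !inE iS jS eq_sym ij /=; lia.
Qed.

Lemma card_common_nbrs_aut (sigma : Johnson n k -> Johnson n k) A B C :
    involutive sigma -> (forall X Y, adj (sigma X) (sigma Y) = adj X Y) ->
  #|common_nbrs (sigma A) (sigma B) (sigma C)| = #|common_nbrs A B C|.
Proof.
move=> sK s_adj; rewrite -(card_imset (common_nbrs A B C) (inv_inj sK)).
apply: eq_card => X; rewrite -[X]sK mem_imset; last exact: inv_inj.
by rewrite !inE !s_adj.
Qed.

(* Take [A] in [P] and [B] outside [P] with [A :&: B] as large as possible, and
   move [A] one step towards [B]. *)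
Lemma johnson_boundary (P : pred (Johnson n k)) A B : P A -> ~~ P B ->
  exists X Y, [/\ P X, ~~ P Y & adj X Y].
Proof.
move=> PA PB.
pose Q (p : Johnson n k * Johnson n k) := P p.1 && ~~ P p.2.
have Q0 : Q (A, B) by rewrite /Q PA.
case: (@arg_maxnP _ (A, B) Q (fun p => #|val p.1 :&: val p.2|) Q0).
move=> [X Y] /andP[/= PX PY] maxXY.
have XY : val X != val Y by apply: contraNneq PY => /val_inj <-.
have [i iX iY] : exists2 i, i \in val X & i \notin val Y.
  apply/subsetPn; apply: contra XY => sXY.
  by rewrite eqEcard sXY !card_johnson leqnn.
have [m mY mX] : exists2 m, m \in val Y & m \notin val X.
  apply/subsetPn; apply: contra XY => sYX.
  by rewrite eq_sym eqEcard sYX !card_johnson leqnn.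
have [Z eZ] := johnson_exchange iX mX.
exists X, Z; split=> //; last by apply/johnson_adjP; exists i, m.
(* If [P Z] held, the pair [(Z, Y)] would beat the maximum: passing from [X] to [Z] gains [m] in [Y]
   and loses only [i], which is not in [Y]. *)
apply/negP=> PZ; have := maxXY (Z, Y); rewrite /Q /= PZ => /(_ PY).
have -> : val Z :&: val Y = m |: (val X :&: val Y).
  apply/setP=> x; rewrite eZ !inE.
  have [->|_] := eqVneq x m; first by rewrite mY.
  by have [->|_] := eqVneq x i; rewrite ?(negbTE iY) ?andbF.
by rewrite cardsU1 inE (negbTE mX) /= add1n ltnn.
Qed.

End Johnson.

Theorem theorem4p15 (n k : nat) (hn : 1 <= n) (hk : k <= n) (hnk : n <> 2 * k) :
  ~ is_square (Johnson n k).
Proof.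
case/square_swap=> s [side [sK s_adj [[A sA] [B sB]] flip same]].
have [||S [P [/eqP sS /eqP sP SP]]] :=
  @johnson_boundary n k (fun X => s X == X) A B; [exact/eqP|exact/eqP|].
have sP' : s (s P) <> s P by move/(inv_inj sK).
have nadj : ~~ adj P (s P).
  by apply/negP=> /(same _ _ sP sP'); rewrite flip //; case: (side P).
have /johnson_adjP[i [m [iS mS eP]]] := SP.
have /johnson_adjP[j [l [jS lS esP]]] : adj S (s P) by rewrite -{1}sS s_adj.
have [ij ml] : i != j /\ m != l.
  move: nadj; rewrite (johnson_adj_exchange iS jS mS lS eP esP).
  case: (eqVneq i j) => [e|_]; case: (eqVneq m l) => // e' _.
  by case: sP; apply: val_inj; rewrite esP eP e e'.
have [Q eQ] := johnson_exchange iS lS.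
(* Otherwise [P], [Q], [s P] would be a path of non-fixed vertices, putting [P] and [s P] on the
   same side. *)
have sQ : s Q = Q.
  apply/eqP/negPn/negP => /eqP nQ.
  have PQ : adj P Q.
    by rewrite (johnson_adj_exchange iS iS mS lS eP eQ) eqxx addTb.
  have QP : adj Q (s P).
    by rewrite (johnson_adj_exchange iS jS lS lS eQ esP) eqxx addbT.
  have := same Q (s P) nQ sP' QP; rewrite flip // (same P Q sP nQ PQ).
  by case: (side Q).
(* Around [S], the vertices [P] and [Q] share row [i], while [s P] and [Q] share column [l];
   equating the two counts gives [n - k - 2 = k - 2]. *)
have := card_common_nbrs_aut S P Q sK s_adj; rewrite sS sQ.
have := card_common_nbrs_row iS mS lS ml eP eQ.
have := card_common_nbrs_col jS iS lS _ esP eQ; rewrite eq_sym ij => /(_ isT).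
lia.
Qed.
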